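(* Let $\widetilde{s}_n$ be the number of unlabeled split graphs on $n$ vertices. Then, as $n\to\infty$, $$\widetilde{s}_n\sim\frac{c(n)}{\lfloor n/2\rfloor!\,\lceil n/2\rceil!}\,2^{n^2/4},$$ where $c(n)=\sum_{k\in\mathbb{Z}}2^{-k^2}$ if $n$ is even and $c(n)=\sum_{k\in\mathbb{Z}}2^{-(k+\frac12)^2}$ if $n$ is odd.
   Context: Graphs are finite and simple. A split graph is a graph whose vertices can be partitioned into two (possibly empty) sets $K$ and $S$ such that $K$ is a clique and $S$ is a stable (independent) set. Unlabeled graphs on $n$ vertices are isomorphism classes of graphs on $n$ vertices. The notation $x_n\sim y_n$ means $\lim_{n\to\infty}x_n/y_n=1$. *)

(* Defs.v *)
From HB Require Import structures.
From mathcomp Require Import all_boot all_order all_algebra all_fingroup.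
From mathcomp Require Import all_classical all_reals all_analysis.

Set Implicit Arguments.
Unset Strict Implicit.
Unset Printing Implicit Defensive.

Import Order.TTheory GRing.Theory Num.Theory.

(* A graph on the vertex type T is given by its edge set: a set of unordered
   pairs of distinct vertices. *)
Definition simple_graph (T : finType) (E : {set {set T}}) : bool :=
  [forall e in E, #|e| == 2].

Definition clique (T : finType) (E : {set {set T}}) (K : {set T}) : bool :=
  [forall x in K, forall y in K, (x != y) ==> ([set x; y]%SET \in E)].

Definition stable (T : finType) (E : {set {set T}}) (S : {set T}) : bool :=
  [forall x in S, forall y in S, (x != y) ==> ([set x; y]%SET \notin E)].

Definition split_graph (T : finType) (E : {set {set T}}) : bool :=
  [exists K : {set T}, exists S : {set T},
     [&& (K :|: S == [set: T])%SET, [disjoint K & S], clique E K & stable E S]].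

Definition graph_iso (T : finType) (E F : {set {set T}}) : bool :=
  [exists p : {perm T},
     [forall x, forall y, ([set x; y]%SET \in E) == ([set p x; p y]%SET \in F)]].

Lemma graph_iso_equivalence (T : finType) : equivalence_rel (@graph_iso T).
Proof.
have sym (E F : {set {set T}}) : graph_iso E F -> graph_iso F E.
  case/existsP=> p /forallP h; apply/existsP; exists (p^-1)%g.
  apply/forallP=> x; apply/forallP=> y.
  by have /forallP/(_ ((p^-1)%g y)) := h ((p^-1)%g x); rewrite !permKV eq_sym.
have trans (F E G : {set {set T}}) :
    graph_iso E F -> graph_iso F G -> graph_iso E G.
  case/existsP=> p /forallP hp /existsP[q /forallP hq].
  apply/existsP; exists (p * q)%g; apply/forallP=> x; apply/forallP=> y.
  have /forallP/(_ y)/eqP-> := hp x.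
  by have /forallP/(_ (p y)) := hq (p x); rewrite !permM.
move=> E F G; split=> [|EF].
  by apply/existsP; exists 1%g; apply/forallP=> x; apply/forallP=> y; rewrite !perm1.
by apply/idP/idP; apply: trans => //; apply: sym.
Qed.

Definition split_graphs (n : nat) : {set {set {set 'I_n}}} :=
  [set E | simple_graph E && split_graph E]%SET.

Definition unlabeled_split_graphs (n : nat) : {set {set {set {set 'I_n}}}} :=
  equivalence_partition (@graph_iso 'I_n) (split_graphs n).

Definition num_unlabeled_split (n : nat) : nat := #|unlabeled_split_graphs n|.

Local Open Scope ring_scope.

(* The sums over the integers have nonnegative terms and are taken in the
   extended reals; both are finite, so that fine returns their value. *)
Definition split_const (R : realType) (n : nat) : R :=
  if odd n
  then fine (\esum_(k in [set: int]) ((2 : R) `^ (- ((k%:~R + 2^-1) ^+ 2)))%:E)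
  else fine (\esum_(k in [set: int]) ((2 : R) `^ (- (k%:~R ^+ 2)))%:E).

(* Main.v *)
Require Import Defs.
From HB Require Import structures.
From mathcomp Require Import all_boot all_order all_algebra all_fingroup.
From mathcomp Require Import all_classical all_reals all_analysis.
From mathcomp Require Import zify ring lra.

(* Let B be the sum over cliques K of size k, with n/4 <= k <= 3n/4, of the
   number 2^(k(n-k)) of split graphs with split partition (K, ~: K).  The number
   of unlabeled split graphs is asymptotic to B / n!.
   From above, it is at most the number of orbits of pairs (K, E); by Burnside
   this is a sum over permutations, in which a permutation moving m > 0 vertices
   contributes at most 2^(-mn/16) times the identity, while there are at most
   n^m of them.
   From below, every isomorphism class has at most n! members, and all but a
   proportion O(n^2 2^(-n/16)) of the pairs (K, E) are determined by E.
   Finally 2^(k(n-k)) = 2^(n^2/4) 2^(-(k-n/2)^2), so that B divided by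
   2^(n^2/4) times the central binomial coefficient is a sum of Gaussian terms
   weighted by ratios of binomials, which are at most 1 and tend to 1 for
   bounded k - n/2. *)

Import Order.TTheory GRing.Theory Num.Theory.
Import numFieldNormedType.Exports.

(** * Split graphs with a given split partition *)

Section SplitGraphs.

Import mathcomp.boot.fintype mathcomp.boot.finset.

Local Open Scope set_scope.
Local Open Scope nat_scope.

Variable T : finType.
Implicit Types (E F : {set {set T}}) (K : {set T}) (p : {perm T}).

Definition split_at K : {set {set {set T}}} :=
  [set E | [&& simple_graph E, clique E K & stable E (~: K)]].

Lemma split_atP E K :
  reflect [/\ forall e, e \in E -> #|e| = 2,
              {in K &, forall x y, x != y -> [set x; y] \in E} &
              {in ~: K &, forall x y, x != y -> [set x; y] \notin E}]
          (E \in split_at K).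
Proof.
rewrite inE; apply: (iffP and3P) => -[Es EK ES]; split.
- by move=> e eE; apply/eqP; move/forall_inP: Es; apply.
- by move=> x y xK yK; move/forall_inP/(_ x xK)/forall_inP/(_ y yK)/implyP: EK; apply.
- by move=> x y xK yK; move/forall_inP/(_ x xK)/forall_inP/(_ y yK)/implyP: ES; apply.
- by apply/forall_inP => e /Es ->.
- by apply/forall_inP => x xK; apply/forall_inP => y yK; apply/implyP; apply: EK.
- by apply/forall_inP => x xK; apply/forall_inP => y yK; apply/implyP; apply: ES.
Qed.

Lemma split_graphP E :
  reflect (exists K, E \in split_at K) (simple_graph E && split_graph E).
Proof.
apply: (iffP andP) => [[Es /existsP[K /existsP[S /and4P[KS dKS EK ES]]]]|[K]].
  exists K; rewrite inE Es EK /=; suff -> : ~: K = S by [].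
  apply/setP => x; rewrite inE.
  have : x \in K :|: S by rewrite (eqP KS) inE.
  rewrite inE.
  have /pred0P/(_ x)/= := dKS.
  by case: (x \in K); case: (x \in S).
rewrite inE => /and3P[-> EK ES]; split=> //.
apply/existsP; exists K; apply/existsP; exists (~: K).
by rewrite setUCr eqxx EK ES -setI_eq0 setICr eqxx.
Qed.

(** Ordered pairs index the unordered ones: [setX K (~: K)] lists each cross pair once, clique
    vertex first. *)
Definition agree_on (D : {set T * T}) E F :=
  forall u, u \in D -> ([set u.1; u.2] \in E) = ([set u.1; u.2] \in F).

Lemma split_at_ext K E F : E \in split_at K -> F \in split_at K ->
  agree_on (setX K (~: K)) E F -> E = F.
Proof.
move=> /split_atP[Es EK ES] /split_atP[Fs FK FS] EF; apply/setP => e.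
have [/cards2P[x [y [xy ->{e}]]]|ne2] := boolP (#|e| == 2); last first.
  by apply/idP/idP => [/Es|/Fs] e2; rewrite e2 in ne2.
have [xK|xK] := boolP (x \in K); have [yK|yK] := boolP (y \in K).
- by rewrite EK ?FK.
- by apply: (EF (x, y)); rewrite !inE xK yK.
- by rewrite setUC; apply: (EF (y, x)); rewrite !inE xK yK.
- by rewrite (negPf (ES _ _ _ _ _)) ?(negPf (FS _ _ _ _ _)) ?inE.
Qed.

(** Recording which pairs of D are edges embeds A into the powerset of D. Later upper bounds for a
    fixed K come from exhibiting a small deciding set D. *)
Lemma card_determined (A : {set {set {set T}}}) (D : {set T * T}) :
  {in A &, forall E F, agree_on D E F -> E = F} -> #|A| <= 2 ^ #|D|.
Proof.
move=> AD; rewrite -card_powerset.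
pose f E := [set u in D | [set u.1; u.2] \in E].
rewrite -(@card_in_imset _ _ f A); last first.
  move=> E F EA FA fEF; apply: AD => // u uD.
  by move/setP/(_ u): fEF; rewrite !inE uD.
apply/subset_leq_card/subsetP => _ /imsetP[E _ ->].
by rewrite powersetE; apply/subsetP => u; rewrite inE => /andP[].
Qed.

Lemma card_cross K : #|setX K (~: K)| = #|K| * (#|T| - #|K|).
Proof. by rewrite cardsX [#|~: K|]cardsCs setCK. Qed.

(** Any set U of cross pairs can be added to the complete graph on K. Distinct U give distinct
    graphs, since a cross pair recovers its orientation from which end lies in K. *)
Lemma card_split_at K : 2 ^ #|setX K (~: K)| <= #|split_at K|.
Proof.
rewrite -card_powerset.
pose g (U : {set T * T}) := [set e : {set T} | (#|e| == 2) &&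
   ((e \subset K) || [exists u in U, e == [set u.1; u.2]])].
rewrite -(@card_in_imset _ _ g); last first.
  move=> U V; rewrite !inE => UC VC gUV.
  have sub (U1 V1 : {set T * T}) : U1 \subset setX K (~: K) ->
      V1 \subset setX K (~: K) -> g U1 = g V1 -> U1 \subset V1.
    move=> /subsetP U1C /subsetP V1C gE; apply/subsetP => -[x y] xyU.
    have := U1C _ xyU; rewrite !inE /= => /andP[xK yK].
    have xy : x != y by apply: contraNneq yK => <-.
    have : [set x; y] \in g U1.
      rewrite inE cards2 xy /=; apply/orP; right.
      by apply/exists_inP; exists (x, y).
    rewrite gE inE => /andP[_ /orP[/subsetP/(_ y)|]].
      by rewrite !inE eqxx orbT (negPf yK) => /(_ isT).
    case/exists_inP => -[a b] abV /eqP /= xyE.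
    have := V1C _ abV; rewrite !inE /= => /andP[aK bK].
    have : a \in [set x; y] by rewrite xyE !inE eqxx.
    have : b \in [set x; y] by rewrite xyE !inE eqxx orbT.
    rewrite !inE => /orP[/eqP bx|/eqP bx]; first by rewrite bx xK in bK.
    case/orP => /eqP ax; last by rewrite -ax aK in yK.
    by rewrite -ax -bx.
  by apply/eqP; rewrite eqEsubset (sub U V) ?(sub V U).
apply/subset_leq_card/subsetP => _ /imsetP[U UC ->]; apply/split_atP; split.
- by move=> e; rewrite inE => /andP[/eqP].
- move=> x y xK yK xy; rewrite inE cards2 xy /=.
  by apply/orP; left; apply/subsetP => z; rewrite !inE => /orP[]/eqP->.
- move=> x y; rewrite !inE => xK yK xy; rewrite cards2 xy /= negb_or.
  apply/andP; split.
    by apply: contra xK => /subsetP; apply; rewrite !inE eqxx.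
  apply/negP => /exists_inP[[a b] abU /eqP /= xyE].
  move: UC; rewrite inE => /subsetP/(_ _ abU); rewrite !inE /= => /andP[aK bK].
  have : a \in [set x; y] by rewrite xyE !inE eqxx.
  by rewrite !inE => /orP[]/eqP ax; rewrite -ax aK in xK yK.
Qed.

Lemma card_split_at_const K (A : {set {set {set T}}}) (R : {set T * T}) b :
  A \subset split_at K -> R \subset setX K (~: K) ->
  (forall E, E \in A -> {in R, forall u, ([set u.1; u.2] \in E) = b}) ->
  #|A| <= 2 ^ (#|setX K (~: K)| - #|R|).
Proof.
move=> /subsetP AK RC AR.
have -> : #|setX K (~: K)| - #|R| = #|setX K (~: K) :\: R|.
  by rewrite -(cardsID R (setX K (~: K))) (setIidPr RC) addKn.
apply: card_determined => E F EA FA EF; apply: (split_at_ext _ _ _ (AK _ EA) (AK _ FA)).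
move=> u uC; have [uR|uR] := boolP (u \in R); first by rewrite !AR.
by apply: EF; rewrite inE uR.
Qed.

(* Two split partitions K, K' of the same graph differ by at most one vertex in
   each direction, so that a vertex of K :\: K' has at most one neighbour
   outside K, and a vertex of K' :\: K at most one non-neighbour in K. *)
Lemma split_at_meet K K' E : E \in split_at K -> E \in split_at K' -> K != K' ->
  (exists x y, x \in K /\ forall z, z \notin K -> z != y -> [set x; z] \notin E) \/
  (exists x y, x \notin K /\ forall z, z \in K -> z != y -> [set z; x] \in E).
Proof.
move=> /split_atP[_ EK ES] /split_atP[_ EK' ES'] KK'.
have [sKK'|nKK'] := boolP (K \subset K'); [right|left].
  have /subsetPn[x xK' xK] : ~~ (K' \subset K).
    by apply: contra KK' => ?; rewrite eqEsubset sKK'.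
  exists x, x; split=> // z zK zx; apply: EK' => //.
  by move/subsetP: sKK'; apply.
have /subsetPn[x xK xK'] := nKK'.
have [[y yK' yK]|noy] := altP (@subsetPn _ K' K).
  exists x, y; split=> // z zK zy.
  have zK' : z \notin K'.
    apply/negP => zK'; have := EK' z y zK' yK' zy; apply/negP.
    by apply: ES => //; rewrite inE.
  by apply: ES'; rewrite ?inE //; apply: contraNneq zK => <-.
exists x, x; split=> // z zK zx; apply: ES'; rewrite ?inE //; last by rewrite eq_sym.
by apply: contra zK; apply/subsetP; rewrite negbK in noy.
Qed.


(** By [split_at_meet] an ambiguous graph falls into one of at most [2 * #|T| ^ 2] families, indexed
    by a kind and a pair (x, y). A family fixes every cross pair at x except possibly the one with
    y, hence at least c pairs, and so loses a factor [2 ^ c]. *)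
Lemma card_not_unique (c : nat) K :
  c < #|K| -> c < #|T| - #|K| ->
  #|[set E in split_at K | [exists K', (K' != K) && (E \in split_at K')]]| * 2 ^ c
    <= 2 * #|T| ^ 2 * 2 ^ #|setX K (~: K)|.
Proof.
move=> cK cS; pose C := setX K (~: K).
have cardC := card_cross K.
pose A1 x y := [set E in split_at K |
  [forall z, (z \notin K) ==> (z != y) ==> ([set x; z] \notin E)]].
pose A2 x y := [set E in split_at K |
  [forall z, (z \in K) ==> (z != y) ==> ([set z; x] \in E)]].
have subA : [set E in split_at K | [exists K', (K' != K) && (E \in split_at K')]]
    \subset (\bigcup_(u in [set u : T * T | u.1 \in K]) A1 u.1 u.2) :|:
            (\bigcup_(u in [set u : T * T | u.1 \notin K]) A2 u.1 u.2).
  apply/subsetP => E; rewrite !inE => /andP[EK /existsP[K' /andP[KK' EK']]].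
  rewrite eq_sym in KK'.
  have EK2 : E \in split_at K by rewrite inE.
  have [[x [y [xK xy]]]|[x [y [xK xy]]]] := split_at_meet _ _ _ EK2 EK' KK';
    apply/orP; [left|right]; apply/bigcupP; exists (x, y); rewrite !inE //= EK /=.
    by apply/forallP => z; apply/implyP => zK; apply/implyP; apply: xy.
  by apply/forallP => z; apply/implyP => zK; apply/implyP; apply: xy.
have A1le x y : x \in K -> #|A1 x y| * 2 ^ c <= 2 ^ #|C|.
  move=> xK; pose R := [set (x, z) | z in ~: K :\ y].
  have RC : R \subset C.
    apply/subsetP => _ /imsetP[z + ->]; rewrite in_setD1 in_setC => /andP[_ zK].
    by rewrite /C !inE /= xK.
  (* The strict bound on c pays for the vertex y removed from R. *)
  have cR : c <= #|R|.
    rewrite card_imset; last by move=> ? ? [].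
    have := cardsD1 y (~: K); rewrite [#|~: K|]cardsCs setCK.
    case: (y \in _); rewrite ?add1n ?add0n => e; last by rewrite -e; apply: ltnW.
    by rewrite -ltnS -e.
  have := subset_leq_card RC => RC'.
  have /(_ false) := card_split_at_const K (A1 x y) R _ _ RC.
  have -> : 2 ^ #|C| = 2 ^ (#|C| - #|R|) * 2 ^ #|R| by rewrite -expnD subnK.
  move=> H; apply: leq_mul; last by rewrite leq_exp2l.
  apply: H; first by apply/subsetP => E; rewrite inE => /andP[].
  move=> E; rewrite inE => /andP[_ /forallP h] _ /imsetP[z + ->].
  rewrite !inE => /andP[zy zK]; apply/negbTE.
  by have /implyP/(_ zK)/implyP/(_ zy) := h z.
have A2le x y : x \notin K -> #|A2 x y| * 2 ^ c <= 2 ^ #|C|.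
  move=> xK; pose R := [set (z, x) | z in K :\ y].
  have RC : R \subset C.
    apply/subsetP => _ /imsetP[z + ->]; rewrite in_setD1 => /andP[_ zK].
    by rewrite /C !inE /= zK xK.
  have cR : c <= #|R|.
    rewrite card_imset; last by move=> ? ? [].
    have := cardsD1 y K.
    case: (y \in _); rewrite ?add1n ?add0n => e; last by rewrite -e; apply: ltnW.
    by rewrite -ltnS -e.
  have := subset_leq_card RC => RC'.
  have /(_ true) := card_split_at_const K (A2 x y) R _ _ RC.
  have -> : 2 ^ #|C| = 2 ^ (#|C| - #|R|) * 2 ^ #|R| by rewrite -expnD subnK.
  move=> H; apply: leq_mul; last by rewrite leq_exp2l.
  apply: H; first by apply/subsetP => E; rewrite inE => /andP[].
  move=> E; rewrite inE => /andP[_ /forallP h] _ /imsetP[z + ->].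
  rewrite !inE => /andP[zy zK] /=.
  by have /implyP/(_ zK)/implyP/(_ zy) := h z.
have cup (P : {set T * T}) (A : T -> T -> {set {set {set T}}}) :
    (forall u, u \in P -> #|A u.1 u.2| * 2 ^ c <= 2 ^ #|C|) ->
    #|\bigcup_(u in P) A u.1 u.2| * 2 ^ c <= #|T| ^ 2 * 2 ^ #|C|.
  move=> h; apply: (@leq_trans (\sum_(u in P) #|A u.1 u.2| * 2 ^ c)).
    rewrite -big_distrl leq_mul2r; apply/orP; right.
    by apply: (big_ind2 (fun (X : {set {set {set T}}}) m => #|X| <= m))
      => [|X m Y m' h1 h2|//];
      rewrite ?cards0 //; apply: leq_trans (leq_card_setU X Y) (leq_add h1 h2).
  apply: (@leq_trans (\sum_(u in P) 2 ^ #|C|)); first exact: leq_sum.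
  by rewrite sum_nat_const leq_mul2r -mulnn -card_prod max_card orbT.
apply: leq_trans (leq_mul (subset_leq_card subA) (leqnn _)) _.
apply: leq_trans (leq_mul (leq_card_setU _ _) (leqnn _)) _.
rewrite mulnDl mul2n -addnn mulnDl leq_add // cup // => u; rewrite inE; [exact: A1le|exact: A2le].
Qed.

(** * Relabellings, isomorphism classes and orbits *)

Definition relabel p E : {set {set T}} := [set p @: (e : {set T}) | e in E].

Lemma imset_pair p x y : p @: [set x; y] = [set p x; p y].
Proof. by rewrite imsetU1 imset_set1. Qed.

Lemma mem_relabel p E (e : {set T}) : (p @: e \in relabel p E) = (e \in E).
Proof. by rewrite mem_imset //; apply/imset_inj/perm_inj. Qed.

Lemma relabel_split_at p K E :
  E \in split_at K -> relabel p E \in split_at (p @: K).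
Proof.
move=> /split_atP[Es EK ES]; apply/split_atP; split.
- by move=> _ /imsetP[e /Es e2 ->]; rewrite card_imset //; apply: perm_inj.
- move=> _ _ /imsetP[x xK ->] /imsetP[y yK ->]; rewrite (inj_eq perm_inj) => xy.
  by rewrite -imset_pair mem_relabel EK.
- move=> x y; rewrite -[x](permKV p) -[y](permKV p) !inE.
  rewrite !(mem_imset _ _ perm_inj) (inj_eq perm_inj) -imset_pair mem_relabel.
  by move=> ? ? ?; apply: ES; rewrite ?inE.
Qed.

Lemma graph_iso_relabel p E : graph_iso E (relabel p E).
Proof.
apply/existsP; exists p; apply/forallP => x; apply/forallP => y.
by rewrite -imset_pair mem_relabel.
Qed.

(** [graph_iso] only tests sets of the form [[set x; y]]; simplicity excludes other members, so the
    permutation carries one edge set exactly onto the other. *)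
Lemma graph_isoP E F : simple_graph E -> simple_graph F ->
  reflect (exists p, F = relabel p E) (graph_iso E F).
Proof.
move=> /forall_inP Es /forall_inP Fs; apply: (iffP idP); last first.
  by move=> [p ->]; apply: graph_iso_relabel.
case/existsP => p /forallP h; exists p; apply/setP => f.
have -> : f = p @: (p^-1%g @: f).
  rewrite -imset_comp -[LHS]imset_id; apply: eq_imset => x /=.
  by rewrite permKV.
rewrite mem_relabel; set e := _ @: f.
have [/cards2P[x [y [xy ->]]]|ne2] := boolP (#|e| == 2).
  by have /forallP/(_ y)/eqP-> := h x; rewrite imset_pair.
have -> : (e \in E) = false by apply/negP => /Es; apply/negP.
apply/negP => /Fs; rewrite card_imset; last exact: perm_inj.
exact/negP.
Qed.

Lemma relabel1 E : relabel 1 E = E.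
Proof.
rewrite -[RHS]imset_id; apply: eq_imset => e.
by rewrite -[RHS]imset_id; apply: eq_imset => x; rewrite perm1.
Qed.

Lemma relabelM p q E : relabel (p * q) E = relabel q (relabel p E).
Proof.
rewrite /relabel -imset_comp; apply: eq_imset => e /=.
by rewrite -imset_comp; apply: eq_imset => x /=; rewrite permM.
Qed.

Definition relabel_pair (x : {set T} * {set {set T}}) p := (p @: x.1, relabel p x.2).

Lemma relabel_pair1 : relabel_pair^~ 1%g =1 id.
Proof.
move=> [K E]; rewrite /relabel_pair /= relabel1; congr pair.
by rewrite -[RHS]imset_id; apply: eq_imset => x; rewrite perm1.
Qed.

Lemma relabel_pairM x : act_morph relabel_pair x.
Proof.
move=> p q; rewrite /relabel_pair /= relabelM; congr pair.
by rewrite -imset_comp; apply: eq_imset => y /=; rewrite permM.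
Qed.

Definition relabel_action := TotalAction relabel_pair1 relabel_pairM.

Definition split_pairs : {set {set T} * {set {set T}}} :=
  [set x | x.2 \in split_at x.1].

Lemma relabel_action_split_pairs :
  [acts [set: {perm T}], on split_pairs | relabel_action].
Proof.
apply/subsetP => p _; rewrite !inE /=; apply/subsetP => -[K E].
by rewrite inE => KE; rewrite 2!inE; apply: relabel_split_at.
Qed.

Definition all_split : {set {set {set T}}} :=
  [set E | simple_graph E && split_graph E].

Definition split_classes := equivalence_partition (@graph_iso T) all_split.

(** Forgetting K maps the orbit of (K, E) onto the class of E, and every class arises so. A graph
    with several split partitions may come from several orbits, hence the inequality. *)
Lemma card_split_classes_orbits :
  #|split_classes| <= #|orbit relabel_action setT @: split_pairs|.
Proof.
pose f (O : {set {set T} * {set {set T}}}) := [set x.2 | x in O].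
apply: leq_trans _ (leq_imset_card f _).
apply/subset_leq_card/subsetP => _ /imsetP[E ES ->].
have := ES; rewrite inE => /split_graphP[K EK].
apply/imsetP; exists (orbit relabel_action setT (K, E)).
  by apply: imset_f; rewrite inE.
have Es : simple_graph E by move: ES; rewrite inE => /andP[].
apply/setP => F; rewrite inE; apply/andP/imsetP.
  case; rewrite inE => /andP[Fs _] /(graph_isoP _ _ Es Fs)[p ->].
  by exists (relabel_pair (K, E) p) => //; apply/orbitP; exists p.
move=> [_ /orbitP[p _ <-] ->] /=; split; last exact: graph_iso_relabel.
by rewrite inE; apply/split_graphP; exists (p @: K); apply: relabel_split_at.
Qed.

(** A class is covered by the relabellings of one member, one for each permutation. *)
Lemma card_split_classes_lower : #|all_split| <= #|split_classes| * (#|T|)`!.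
Proof.
have eqR : {in all_split & &, equivalence_rel (@graph_iso T)}.
  by move=> E F G _ _ _; apply: graph_iso_equivalence.
rewrite (card_partition (equivalence_partitionP eqR)) -sum_nat_const.
apply: leq_sum => _ /imsetP[E ES ->].
have -> : (#|T|)`! = #|[set: {perm T}]|.
  rewrite -cardsT -card_perm; apply: eq_card => p; rewrite !inE.
  by apply/subsetP => x; rewrite inE.
apply: leq_trans _ (leq_imset_card (fun p => relabel p E) _).
apply/subset_leq_card/subsetP => F; rewrite !inE => /andP[/andP[Fs _]].
move: ES; rewrite inE => /andP[Es _] /(graph_isoP _ _ Es Fs)[p ->].
exact: imset_f.
Qed.

Definition fixed_split p K := [set E in split_at K | relabel p E == E].

(** Cauchy-Frobenius turns orbits times group order into a count of pairs (K, E) fixed by p, which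
    is then sorted by K. *)
Lemma card_split_classes_upper :
  #|split_classes| * (#|T|)`! <=
    \sum_(K : {set T}) \sum_(p : {perm T} | p @: K == K) #|fixed_split p K|.
Proof.
have <- : #|[set: {perm T}]| = (#|T|)`!.
  rewrite -cardsT -card_perm; apply: eq_card => p; rewrite !inE.
  by symmetry; apply/subsetP => x; rewrite inE.
apply: leq_trans (leq_mul card_split_classes_orbits (leqnn _)) _.
rewrite -(Frobenius_Cauchy relabel_action_split_pairs).
rewrite (exchange_big_dep xpredT) //= (eq_bigl xpredT) => [|p]; last by rewrite inE.
apply: leq_sum => p _; rewrite -sum1_card.
have fixP x : x \in 'Fix_(split_pairs | relabel_action)[p]%g ->
    [/\ x.2 \in split_at x.1, p @: x.1 = x.1 & relabel p x.2 = x.2].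
  by rewrite !inE sub1set inE => /andP[x2 /eqP]; case: x x2 => K E /= ? [].
rewrite (partition_big fst (fun K => p @: K == K)) /= => [|x /fixP[_ -> _] //].
apply: leq_sum => K _; rewrite sum1dep_card.
rewrite -(@card_in_imset _ _ snd); last first.
  move=> [K1 E1] [K2 E2]; rewrite !inE /= => /andP[_ /eqP->] /andP[_ /eqP->].
  by move=> ->.
apply/subset_leq_card/subsetP => _ /imsetP[x + ->].
rewrite inE => /andP[/fixP[x2 _ px] /eqP <-].
by rewrite in_set x2 px eqxx.
Qed.

(** * Permutations sorted by the number of moved vertices *)

Definition moved p := [set x | p x != x].

Lemma moved_gt0 p : p != 1%g -> 0 < #|moved p|.
Proof.
move=> p1; rewrite card_gt0; apply: contraNneq p1 => M0.
apply/eqP/permP => x; rewrite perm1; apply/eqP.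
by move/setP/(_ x): M0; rewrite !inE => /negbFE.
Qed.

Lemma ffact_le_exp n m : n ^_ m <= n ^ m.
Proof.
elim: m n => [|m IH] [|n] //.
rewrite ffactSS expnS leq_mul2l /=; apply: leq_trans (IH n) _.
by case: m {IH} => // m; rewrite leq_exp2r.
Qed.

(** A permutation whose moved set is A permutes A, so choosing A and then p gives at most a falling
    factorial. *)
Lemma card_moved m : #|[set p : {perm T} | #|moved p| == m]| <= #|T| ^ m.
Proof.
apply: leq_trans (ffact_le_exp _ _); rewrite -bin_ffact -card_draws -sum1_card.
rewrite (partition_big moved (fun A => A \in [set A : {set T} | #|A| == m])) /=; last first.
  by move=> p; rewrite !inE.
rewrite -sum_nat_const; apply: leq_sum => A; rewrite inE => /eqP <-.
rewrite -card_perm sum1dep_card; apply/subset_leq_card/subsetP => p.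
rewrite inE => /andP[_ /eqP <-]; apply/subsetP => x.
by rewrite !inE.
Qed.

(* A relabelling-invariant split graph is determined by one cross pair from each
   orbit, and every orbit of moved cross pairs has at least two elements. *)
Lemma card_fixed_split p K c : p @: K = K -> 4 * c <= #|K| -> 4 * c <= #|T| - #|K| ->
  #|fixed_split p K| * 2 ^ (#|moved p| * c) <= 2 ^ #|setX K (~: K)|.
Proof.
move=> pK ck cl.
pose f (u : T * T) := (p u.1, p u.2).
have finj : injective f by move=> [a b] [a' b'] [/perm_inj -> /perm_inj ->].
pose C := setX K (~: K).
have pKE x : (p x \in K) = (x \in K) by rewrite -{1}pK mem_imset //; apply: perm_inj.
have fC u : (f u \in C) = (u \in C) by rewrite !inE /= !pKE.
pose D := [set u in C | froot f u == u].
have froot_inv (k : T * T -> bool) : (forall u, k (f u) = k u) -> forall u, k (froot f u) = k u.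
  move=> kf u; symmetry.
  by apply: (fconnect_invariant _ (connect_root _ u)) => v; rewrite /= kf eqxx.
have cD : #|fixed_split p K| <= 2 ^ #|D|.
  apply: card_determined => E F; rewrite !inE.
  move=> /andP[EK /eqP pE] /andP[FK /eqP pF] EF.
  apply: (split_at_ext K); rewrite ?inE // => u uC.
  have inv G : relabel p G = G ->
      forall v, ([set (f v).1; (f v).2] \in G) = ([set v.1; v.2] \in G).
    by move=> pG v; rewrite /= -imset_pair -{1}pG mem_relabel.
  rewrite -(froot_inv _ (inv E pE)) -(froot_inv _ (inv F pF)).
  apply: EF; rewrite in_set (froot_inv (fun v => v \in C)) // uC /=.
  by rewrite root_root //; apply: fconnect_sym.
pose M := [set u in C | f u != u].
have D2 : 2 * #|D| <= #|C| + #|C :\: M|.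
  (* Roots in M and their images under f are disjoint subsets of M: f moves each such root within
     its orbit, which has only one root. *)
  have DM : 2 * #|D :&: M| <= #|M|.
    have dis : [disjoint D :&: M & f @: (D :&: M)].
      rewrite -setI_eq0; apply/eqP/setP => u; rewrite in_setI [RHS]inE; apply/negP.
      case/andP => uDM /imsetP[v vDM uv]; move: uDM vDM; rewrite uv !inE.
      case/andP => /andP[_ /eqP fv] _ /andP[/andP[_ /eqP v0] /andP[_]].
      have : froot f v = froot f (f v).
        by apply/(fingraph.rootP (fconnect_sym finj)); apply: fconnect1.
      by rewrite fv v0 => <-; rewrite eqxx.
    have cU : #|(D :&: M) :|: f @: (D :&: M)| = #|D :&: M| + #|f @: (D :&: M)|.
      by apply/eqP; rewrite (leq_card_setU _ _).2.
    rewrite mul2n -addnn -{2}(card_imset (D :&: M) finj) -cU.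
    apply: subset_leq_card; apply/subsetP => u; rewrite in_setU => /orP[].
      by rewrite in_setI => /andP[].
    case/imsetP => v; rewrite in_setI => /andP[_]; rewrite in_set => /andP[vC fv] ->.
    by rewrite in_set fC vC (inj_eq finj).
  have MC : M \subset C by apply/subsetP => u; rewrite in_set => /andP[].
  have DC : D :\: M \subset C :\: M.
    by apply: setSD; apply/subsetP => u; rewrite in_set => /andP[].
  have := cardsID M D; have := cardsID M C; rewrite (setIidPr MC).
  have := subset_leq_card DC; lia.
have CM : C :\: M = setX (K :\: moved p) (~: K :\: moved p).
  apply/setP => -[x y]; rewrite !inE /= xpair_eqE !negb_and.
  by case: (x \in K); case: (y \in K); case: (p x == x); case: (p y == y).
have eK := cardsID (moved p) K.
have eS := cardsID (moved p) (~: K); rewrite [#|~: K|]cardsCs setCK in eS.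
have eM := cardsID K (moved p).
rewrite [moved p :\: K]setDE [moved p :&: ~: K]setIC [moved p :&: K]setIC in eM.
have CE : #|C| = #|K| * (#|T| - #|K|) := card_cross K.
rewrite CM cardsX CE in D2.
rewrite -/C CE -eM.
apply: leq_trans (leq_mul cD (leqnn _)) _; rewrite -expnD leq_exp2l //.
move: D2 ck cl; rewrite -eS -eK.
move: #|D| #|K :&: moved p| #|K :\: moved p| #|~: K :&: moved p| #|~: K :\: moved p|.
move=> d a k b l D2 ck cl.
(* The moved cross pairs number at least half of a * (b + l) + b * (a + k), the pairs with both ends
   moved being counted twice there. Orbits of size at least 2 halve again, which accounts for the
   4. *)
have h1 : 4 * c * b <= (a + k) * b by rewrite leq_mul2r ck orbT.
have h2 : 4 * c * a <= (b + l) * a by rewrite leq_mul2r cl orbT.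
by nia.
Qed.

(** Relative to the identity, the layer of permutations moving m > 0 of the n vertices weighs at
    most (n / 2^c)^m <= n / 2^c, and there are n such layers. *)
Lemma sum_fixed_split K c : #|T| <= 2 ^ c -> 4 * c <= #|K| -> 4 * c <= #|T| - #|K| ->
  (\sum_(p : {perm T} | p @: K == K) #|fixed_split p K|) * 2 ^ c
    <= (2 ^ c + #|T| ^ 2) * 2 ^ #|setX K (~: K)|.
Proof.
move=> nc ck cl; set C := setX K (~: K); pose n := #|T|.
have id1 : (1%g : {perm T}) @: K == K.
  by apply/eqP; rewrite -[RHS]imset_id; apply: eq_imset => x; rewrite perm1.
have fle p m : p @: K == K -> #|moved p| = m -> #|fixed_split p K| * 2 ^ (m * c) <= 2 ^ #|C|.
  by move=> /eqP pK <-; apply: card_fixed_split.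
rewrite (bigD1 1%g id1) /= mulnDl mulnDl; apply: leq_add.
  rewrite mulnC leq_mul2l; apply/orP; right.
  have := fle 1%g 0 id1; rewrite mul0n expn0 muln1; apply.
  by apply/eqP; rewrite cards_eq0; apply/eqP/setP => x; rewrite !inE perm1 eqxx.
have layer (m : 'I_n.+1) :
    (\sum_(p : {perm T} | (p @: K == K) && (p != 1%g) && (#|moved p| == m))
        #|fixed_split p K|) * 2 ^ c <= n * 2 ^ #|C|.
  case: m => -[|m] /= _.
    rewrite big1 ?mul0n // => p /andP[/andP[_ p1]].
    by have := moved_gt0 p p1; case: #|moved p|.
  rewrite -(@leq_pmul2r (2 ^ (m * c))) ?expn_gt0 //.
  rewrite -[X in X <= _]mulnA -expnD -mulSn big_distrl /=.
  apply: (@leq_trans (\sum_(p : {perm T} | #|moved p| == m.+1) 2 ^ #|C|)).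
    rewrite big_mkcond [X in _ <= X]big_mkcond; apply: leq_sum => p _.
    have [/andP[/andP[pK _] /eqP pm]|//] := ifP.
    by rewrite pm eqxx fle.
  rewrite sum_nat_const mulnAC leq_mul2r; apply/orP; right.
  have -> : #|[pred p : {perm T} | #|moved p| == m.+1]|
      = #|[set p : {perm T} | #|moved p| == m.+1]|.
    by apply: eq_card => p; rewrite inE.
  apply: leq_trans (card_moved _) _.
  rewrite expnS leq_mul2l mulnC expnM; apply/orP; right.
  by case: m => // m; rewrite leq_exp2r.
rewrite (partition_big (fun p => inord #|moved p| : 'I_n.+1) xpredT) //= big_distrl /=.
apply: (@leq_trans (\sum_(m < n.+1 | m != ord0) n * 2 ^ #|C|)).
  rewrite [X in _ <= X]big_mkcond; apply: leq_sum => m _.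
  have mv p : (inord #|moved p| == m) = (#|moved p| == m).
    by rewrite -val_eqE /= inordK // ltnS; apply: max_card.
  under eq_bigl do rewrite mv.
  have [_|/negbFE/eqP->] := ifP; first exact: layer.
  rewrite big1 ?mul0n // => p /andP[/andP[_ p1]].
  by have := moved_gt0 p p1; case: #|moved p|.
rewrite sum_nat_const cardC1 card_ord /= mulnA mulnn //.
Qed.

Definition unique_split K : {set {set {set T}}} :=
  split_at K :\: [set E in split_at K | [exists K', (K' != K) && (E \in split_at K')]].

(** The families [unique_split K] are disjoint for distinct K. *)
Lemma sum_unique_split (P : pred {set T}) :
  \sum_(K | P K) #|unique_split K| <= #|all_split|.
Proof.
under eq_bigr do rewrite -sum1_card.
rewrite (exchange_big_dep [in all_split]) /=; last first.
  move=> K E _; rewrite inE => /andP[_ EK]; rewrite inE.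
  by apply/split_graphP; exists K.
rewrite -sum1_card; apply: leq_sum => E _.
rewrite sum1dep_card leqNgt; apply/negP.
case/card_gt1P => K [K' []].
rewrite in_set => /andP[_]; rewrite in_setD => /andP[nK EK].
rewrite in_set => /andP[_]; rewrite in_setD => /andP[_ EK'] KK'.
move/negP: nK; apply; rewrite in_set EK /=; apply/existsP; exists K'.
by rewrite eq_sym KK'.
Qed.

(* Outside this range of clique sizes the crude bound [2 ^ (k * (n - k)) <=
   2 ^ (3 n^2 / 16)] already beats the factor [n! * 2^n]. *)
Definition central n k := (n <= 4 * k) && (n <= 4 * (n - k)).

End SplitGraphs.

(** * Unlabeled split graphs against the central sum *)

Section Counting.

Local Open Scope nat_scope.

Import mathcomp.boot.fintype mathcomp.boot.finset.

(** The quantity B, with the cliques sorted by size. *)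
Definition central_sum n := \sum_(k < n.+1 | central n k) 'C(n, k) * 2 ^ (k * (n - k)).

Lemma sum_sets n (P : pred nat) (f : nat -> nat) :
  \sum_(K : {set 'I_n} | P #|K|) f #|K| = \sum_(k < n.+1 | P k) 'C(n, k) * f k.
Proof.
rewrite (partition_big (fun K : {set 'I_n} => inord #|K| : 'I_n.+1) (fun k => P k)) /=; last first.
  by move=> K PK; rewrite inordK // ltnS -[X in _ <= X](card_ord n) max_card.
apply: eq_bigr => k Pk.
have -> : 'C(n, k) = #|[set K : {set 'I_n} | #|K| == k]| by rewrite card_draws card_ord.
rewrite -sum_nat_const; apply: eq_big => K.
  rewrite inE -val_eqE /= inordK ?ltnS -?[X in _ <= X](card_ord n) ?max_card //.
  by case: eqP => [->|]; rewrite ?Pk ?andbF.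
move=> /andP[_ /eqP <-]; rewrite inordK // ltnS -[X in _ <= X](card_ord n) max_card //.
Qed.

(** Source of the 16: k and n - k are at least n / 4, and [card_fixed_split] needs 4 * c below
    each. *)
Lemma central_div16 n k : central n k -> 4 * (n %/ 16) <= k /\ 4 * (n %/ 16) <= n - k.
Proof. by rewrite /central => /andP[]; lia. Qed.

(** Only graphs with a unique split partition of central size are kept, so that none is counted
    twice; [card_not_unique] with c = n / 16 bounds the loss. *)
Lemma num_split_lower n : 16 <= n ->
  central_sum n * 2 ^ (n %/ 16)
    <= num_unlabeled_split n * n`! * 2 ^ (n %/ 16) + 2 * n ^ 2 * central_sum n.
Proof.
move=> n16; set q := n %/ 16; have q0 : 0 < q by rewrite divn_gt0.
pose T := 'I_n : finType; have cT : #|T| = n by rewrite card_ord.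
have -> : central_sum n = \sum_(K : {set T} | central n #|K|) 2 ^ #|setX K (~: K)|.
  rewrite /central_sum -(sum_sets n (central n) (fun k => 2 ^ (k * (n - k)))).
  by apply: eq_bigr => K _; rewrite card_cross cT.
have low := card_split_classes_lower T; rewrite cT in low.
have uni := sum_unique_split T (fun K => central n #|K|).
apply: (@leq_trans ((\sum_(K : {set T} | central n #|K|) #|unique_split T K|) * 2 ^ q
    + 2 * n ^ 2 * \sum_(K : {set T} | central n #|K|) 2 ^ #|setX K (~: K)|)); last first.
  by rewrite leq_add2r leq_mul2r (leq_trans uni low) orbT.
rewrite !big_distrl /= big_distrr -big_split /=.
have q4 : q < 4 * q by rewrite -/q; move: q q0 => q'; lia.
apply: leq_sum => K /central_div16 [k1 k2].
have := card_not_unique T q K; rewrite cT => h; have {h} := h (leq_trans q4 k1) (leq_trans q4 k2).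
set N := [set E in _ | _] => Nle.
apply: leq_trans (leq_mul (card_split_at T K) (leqnn _)) _.
rewrite -(cardsID N (split_at T K)) mulnDl addnC leq_add2l.
apply: leq_trans _ Nle; rewrite leq_mul2r; apply/orP; right.
by apply: subset_leq_card; apply: subsetIr.
Qed.

(** The Burnside sum is cut by clique size. For central K [sum_fixed_split] applies; for any other K
    each permutation is charged a bound for all split graphs at K. *)
Lemma num_split_upper n : n <= 2 ^ (n %/ 16) ->
  num_unlabeled_split n * n`! * 2 ^ (n %/ 16)
    <= (2 ^ (n %/ 16) + n ^ 2) * central_sum n
       + 2 ^ (n %/ 16) * (n`! * 2 ^ n * 2 ^ (3 * n ^ 2 %/ 16)).
Proof.
set q := n %/ 16 => nq; pose T := 'I_n : finType; have cT : #|T| = n by rewrite card_ord.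
have -> : central_sum n = \sum_(K : {set T} | central n #|K|) 2 ^ #|setX K (~: K)|.
  rewrite /central_sum -(sum_sets n (central n) (fun k => 2 ^ (k * (n - k)))).
  by apply: eq_bigr => K _; rewrite card_cross cT.
have up := card_split_classes_upper T; rewrite cT in up.
apply: leq_trans (leq_mul up (leqnn _)) _.
rewrite (bigID (fun K : {set T} => central n #|K|)) /= mulnDl; apply: leq_add.
  rewrite big_distrl big_distrr /=; apply: leq_sum => K /central_div16[k1 k2].
  by have := sum_fixed_split T K q; rewrite cT; apply.
rewrite mulnC leq_mul2l; apply/orP; right.
apply: (@leq_trans (\sum_(K : {set T}) n`! * 2 ^ (3 * n ^ 2 %/ 16))); last first.
  rewrite sum_nat_const -[X in X * _]/(#|{set T}|) -cardsT.
  have -> : #|[set: {set T}]| = 2 ^ n by rewrite -cT -cardsT -card_powerset powersetT.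
  by rewrite mulnCA mulnA.
rewrite big_mkcond; apply: leq_sum => K _; case: ifP => // Kfar.
have k_le : #|K| <= n by rewrite -[X in _ <= X]cT max_card.
(* Here k or n - k is below n / 4, so k * (n - k) is at most its value at k = n / 4. *)
have cC : #|setX K (~: K)| <= 3 * n ^ 2 %/ 16.
  rewrite card_cross cT leq_divRL //; move: Kfar k_le; rewrite /central.
  by move: #|K| => k; nia.
apply: (@leq_trans (\sum_(p : {perm T}) 2 ^ (3 * n ^ 2 %/ 16))).
  rewrite big_mkcond; apply: leq_sum => p _; case: ifP => // _.
  apply: leq_trans (_ : _ <= 2 ^ #|setX K (~: K)|) _; last by rewrite leq_exp2l.
  apply: card_determined => E F; rewrite !in_set => /andP[EK _] /andP[FK _].
  by apply: split_at_ext; rewrite ?in_set.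
by rewrite sum_nat_const (_ : #|_| = n`!) //= -card_Sn; apply: eq_card => p; rewrite !inE.
Qed.

End Counting.

(** * Central binomial coefficients *)

Section Binomials.

Local Open Scope nat_scope.

(** Past the middle the quotient (n - k) / (k + 1) of consecutive binomials is at most 1; below it,
    symmetry applies. *)
Lemma bin_uphalf_max n k : 'C(n, k) <= 'C(n, uphalf n).
Proof.
have up d : 'C(n, uphalf n + d) <= 'C(n, uphalf n).
  elim: d => [|d IH]; first by rewrite addn0.
  apply: leq_trans IH; rewrite addnS; have := mul_bin_left n (uphalf n + d).
  have : n - (uphalf n + d) <= (uphalf n + d).+1 by lia.
  move: (uphalf n + d) => k1.
  move: 'C(n, _) 'C(n, _) (n - _) => a b m; nia.
have [k1|k1] := leqP (uphalf n) k; first by rewrite -(subnKC k1).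
have kn : k <= n by lia.
rewrite -bin_sub //; have k2 : uphalf n <= n - k by lia.
by rewrite -(subnKC k2).
Qed.

(** Subtraction-free form of a ratio at least 1 - d (d + 1) / g, with g = [uphalf n]. Going from d
    to d + 1 costs at most 2 (d + 1) / g of the central binomial. *)
Lemma bin_uphalf_add n d :
  'C(n, uphalf n) * uphalf n
    <= 'C(n, uphalf n + d) * uphalf n + d * d.+1 * 'C(n, uphalf n).
Proof.
elim: d => [|d IH]; first by rewrite addn0 leq_addr.
apply: leq_trans IH _; rewrite addnS.
have := mul_bin_left n (uphalf n + d).
have := bin_uphalf_max n (uphalf n + d).
have := bin_uphalf_max n (uphalf n + d).+1.
have : uphalf n <= (n - (uphalf n + d)) + d.+1 by lia.
move: 'C(n, _) 'C(n, _) 'C(n, _) (n - _) => M c' c m; move: (uphalf n) => g.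
nia.
Qed.

Lemma bin_uphalf_sub n d : d <= uphalf n ->
  'C(n, uphalf n) * uphalf n
    <= 'C(n, uphalf n - d) * uphalf n + d * d.+1 * 'C(n, uphalf n).
Proof.
move=> dg; rewrite -['C(n, _ - d)]bin_sub; last by lia.
(* Reflection sends g - d to g + d for even n, but to g + d - 1 for odd n. *)
have [on|en] := boolP (odd n).
  case: d dg => [|d] dg; first by rewrite subn0 bin_sub ?leq_addr //; lia.
  have -> : n - (uphalf n - d.+1) = uphalf n + d by lia.
  apply: leq_trans (bin_uphalf_add n d) _; rewrite leq_add2l leq_mul2r; apply/orP; right.
  by rewrite leq_mul.
have -> : n - (uphalf n - d) = uphalf n + d by lia.
exact: bin_uphalf_add.
Qed.

(** With s = n / 64, the bound s + 1 <= 2^s raised to the fourth power gives the exponent 4 s <= n /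
    16. *)
Lemma cube_le_exp n : n ^ 3 <= 64 ^ 3 * 2 ^ (n %/ 16).
Proof.
pose s := n %/ 64.
have h1 : n <= 64 * s.+1 by lia.
apply: (@leq_trans ((64 * s.+1) ^ 3)).
  by rewrite (leq_exp2r _ _ (isT : 0 < 3)).
rewrite expnMn.
rewrite leq_mul2l; apply/orP; right.
apply: (@leq_trans (2 ^ (4 * s))); last by rewrite leq_exp2l //; lia.
rewrite mulnC expnM; apply: (@leq_trans (s.+1 ^ 4)); first by rewrite leq_pexp2l.
by rewrite leq_exp2r // ltn_expl.
Qed.

(** From n = 1024 on, n^2 exceeds 2 * 64^3, so two of the three factors n absorb the constant. *)
Lemma double_le_exp n : 1024 <= n -> 2 * n <= 2 ^ (n %/ 16).
Proof.
move=> n1; have := cube_le_exp n; set m := 2 ^ _ => h.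
have h2 : 2 * 64 ^ 3 <= n ^ 2.
  have -> : 64 = 2 ^ 6 by [].
  rewrite -expnM -expnS; apply: (@leq_trans ((2 ^ 10) ^ 2)).
    by rewrite -expnM leq_exp2l.
  by rewrite (leq_exp2r _ _ (isT : 0 < 2)).
rewrite -(@leq_pmul2l (64 ^ 3)) ?expn_gt0 //; apply: leq_trans h.
by rewrite (expnSr n 2) mulnA leq_mul2r (mulnC (64 ^ 3)) h2 orbT.
Qed.

Lemma fact_le_exp n : n`! <= n ^ n.
Proof. by rewrite -ffactnn; apply: ffact_le_exp. Qed.

(** The factor n! 2^n is at most (2n)^n <= 2n * 2^(q (n - 1)) with q = n / 16. The extra 2^q
    completes the exponent q n <= n^2 / 16, which fills the gap between 3/16 and 1/4. *)
Lemma far_sum_bound n : 1024 <= n ->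
  n`! * 2 ^ n * 2 ^ (3 * n ^ 2 %/ 16) * 2 ^ (n %/ 16) <= n ^ 2 * 2 ^ (n ^ 2 %/ 4).
Proof.
move=> n1; have n2 := double_le_exp n n1; set q := n %/ 16 in n2 *.
apply: (@leq_trans ((2 * n) ^ n * 2 ^ (3 * n ^ 2 %/ 16) * 2 ^ q)).
  by rewrite !leq_mul2r expnMn [n`! * _]mulnC leq_mul2l fact_le_exp !orbT.
have -> : (2 * n) ^ n = 2 * n * (2 * n) ^ n.-1 by rewrite -expnS prednK //; lia.
apply: (@leq_trans (2 * n * (2 ^ q) ^ n.-1 * 2 ^ (3 * n ^ 2 %/ 16) * 2 ^ q)).
  rewrite !leq_mul2r; apply/orP; right; apply/orP; right; rewrite leq_mul2l.
  by apply/orP; right; rewrite leq_exp2r //; lia.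
rewrite -!mulnA mulnA [X in _ <= X]mulnA; apply: leq_mul.
  by rewrite leq_mul2r (leq_trans _ n1) ?orbT.
rewrite -expnM -!expnD leq_exp2l //.
have -> : q * n.-1 + (3 * n ^ 2 %/ 16 + q) = q * n + 3 * n ^ 2 %/ 16.
  by rewrite addnA addnAC -mulnSr prednK //; lia.
have : q * n * 16 <= n ^ 2 by rewrite -mulnn /q; nia.
lia.
Qed.

End Binomials.

(** * Gaussian sums *)

Section Gauss.

Local Open Scope ring_scope.

Variable R : realType.

Lemma ler_sum_subseq (I : eqType) (F : I -> R) (s t : seq I) :
  (forall i, 0 <= F i) -> uniq s -> {subset s <= t} ->
  \sum_(i <- s) F i <= \sum_(i <- t) F i.
Proof.
move=> F0; elim: s t => [|x s IH] t /=; first by rewrite big_nil sumr_ge0.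
move=> /andP[xs us] st; have xt : x \in t by apply: st; rewrite inE eqxx.
rewrite big_cons (perm_big _ (perm_to_rem xt)) big_cons lerD2l.
apply: IH => // y ys; have := st y; rewrite inE ys orbT => /(_ isT).
rewrite (perm_mem (perm_to_rem xt)) inE => /predU1P[yx|//].
by rewrite -yx ys in xs.
Qed.

(** The uniform bound M makes the extended sum finite, so [fine] keeps its value and the supremum
    properties pass to real numbers. *)
Lemma fine_esum_adherent (T : choiceType) (f : T -> R) (M : R) :
  (forall i, 0 <= f i) -> (forall s, uniq s -> \sum_(i <- s) f i <= M) ->
  let c := fine (\esum_(i in [set: T]%classic) (f i)%:E) in
  (forall s, uniq s -> \sum_(i <- s) f i <= c) /\
  (forall e, 0 < e -> exists2 s, uniq s & c - e < \sum_(i <- s) f i).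
Proof.
move=> f0 fM.
have ub s : uniq s ->
    ((\sum_(i <- s) f i)%:E <= \esum_(i in [set: T]%classic) (f i)%:E)%E.
  move=> us; apply: esum_ge; exists [set` s]%classic.
    by split => //; apply: finite_seq.
  by rewrite -fsbig_seq // sumEFin.
have fin : \esum_(i in [set: T]%classic) (f i)%:E \is a fin_num.
  rewrite ge0_fin_numE ?esum_ge0 // => [|i _]; last by rewrite lee_fin.
  apply: (@le_lt_trans _ _ M%:E); last exact: ltry.
  apply: ge_ereal_sup => _ [A [Afin _] <-].
  by rewrite fsbig_finite // sumEFin lee_fin fM ?finmap.fset_uniq.
split=> [s us|e e0].
  by rewrite -lee_fin fineK // ub.
have [_ [A [Afin _] <-]] := ub_ereal_sup_adherent e0 fin.
rewrite fsbig_finite //= sumEFin => lt.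
exists (finmap.enum_fset (fset_set A)); first exact: finmap.fset_uniq.
by rewrite -lte_fin EFinB fineK.
Qed.

(* With [k = uphalf n + i], the shifted square is [(k - n / 2) ^ 2] for both
   parities of [n]. *)
Definition gauss (n : nat) (i : int) : R :=
  2 `^ (- ((i%:~R + (odd n)%:R / 2) ^+ 2)).

Lemma gauss_ge0 n i : 0 <= gauss n i.
Proof. exact: powR_ge0. Qed.

Lemma split_constE n :
  split_const R n = fine (\esum_(i in [set: int]%classic) (gauss n i)%:E).
Proof.
rewrite /split_const /gauss; case: odd => //.
  by congr fine; apply: eq_esum => i _; rewrite div1r.
by congr fine; apply: eq_esum => i _; rewrite mul0r addr0.
Qed.

Lemma gauss_le n i : gauss n i <= 2 * 2^-1 ^+ absz i.
Proof.
have -> : 2 * 2^-1 ^+ absz i = 2 `^ (1 - `|i%:~R : R|).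
  rewrite powRD; last by apply/implyP.
  by rewrite powRr1 // powRN -intr_norm -natr_absz powR_mulrn // exprVn.
apply: ler_powR; first by lra.
set x : R := i%:~R; have [x0|x0] := leP 0 x.
  by rewrite ger0_norm //; case: odd; rewrite /= ?mulr1n ?mulr0n; nra.
have := sqr_ge0 (x + 1).
by rewrite ltr0_norm //; case: odd; rewrite /= ?mulr1n ?mulr0n; nra.
Qed.

Lemma sum_half_le N : \sum_(k <- iota 0 N) (2^-1 : R) ^+ k <= 2.
Proof.
suff -> : \sum_(k <- iota 0 N) (2^-1 : R) ^+ k = 2 - 2 * 2^-1 ^+ N.
  by have : (0 : R) <= 2^-1 ^+ N by []; lra.
elim: N => [|N IH]; first by rewrite big_nil expr0; lra.
rewrite -addn1 iotaD big_cat big_seq1 IH addn1 exprS add0n /=; set z := _ ^+ N; lra.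
Qed.

Lemma gauss_sum_le n s : uniq s -> \sum_(i <- s) gauss n i <= 8.
Proof.
move=> us; pose N := (\max_(i <- s) absz i).+1.
(* The index 0 occurs twice, which only enlarges the upper bound; each half contributes at most
   4. *)
pose t := [seq Posz k | k <- iota 0 N] ++ [seq - Posz k | k <- iota 0 N].
have st : {subset s <= t}.
  move=> i si; have iN : (absz i < N)%N by rewrite ltnS; apply: leq_bigmax_seq.
  rewrite mem_cat; apply/orP; case: i si iN => k _; rewrite [absz _]/= => kN; [left|right].
    by apply/seq.mapP; exists k; rewrite ?mem_iota.
  by apply/seq.mapP; exists k.+1; rewrite ?mem_iota // NegzE.
apply: le_trans (ler_sum_subseq _ _ _ _ (gauss_ge0 n) us st) _.
rewrite big_cat !big_map /=.
have h : \sum_(k <- iota 0 N) (2 : R) * 2^-1 ^+ k <= 4.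
  by rewrite -mulr_sumr; have := sum_half_le N; lra.
have -> : (8 : R) = 4 + 4 by lra.
apply: lerD; apply: le_trans h; apply: ler_sum => k _.
  exact: (gauss_le n (Posz k)).
by have := gauss_le n (- Posz k); rewrite abszN.
Qed.

Lemma split_const_ub n s : uniq s -> \sum_(i <- s) gauss n i <= split_const R n.
Proof.
move=> us; rewrite split_constE.
by apply: (fine_esum_adherent _ _ _ (gauss_ge0 n) (@gauss_sum_le n)).1.
Qed.

Lemma split_const_adherent n (e : R) : 0 < e ->
  exists2 s, uniq s & split_const R n - e < \sum_(i <- s) gauss n i.
Proof.
move=> e0; rewrite split_constE.
by apply: (fine_esum_adherent _ _ _ (gauss_ge0 n) (@gauss_sum_le n)).2.
Qed.

(** The term at 0 suffices. This lets additive errors be read as relative ones. *)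
Lemma split_const_ge n : 2^-1 <= split_const R n.
Proof.
apply: le_trans (split_const_ub n [:: 0] isT); rewrite big_seq1 /gauss.
rewrite -[X in X <= _]powR_inv1 //; apply: ler_powR; first by lra.
by rewrite mulr0z add0r; case: odd; rewrite /= ?mulr1n ?mulr0n; lra.
Qed.

Lemma gauss_odd n m : odd n = odd m -> gauss n =1 gauss m.
Proof. by move=> nm i; rewrite /gauss nm. Qed.

Lemma split_const_odd n m : odd n = odd m -> split_const R n = split_const R m.
Proof. by rewrite /split_const => ->. Qed.

(** * The central sum against the Gaussian series *)

Definition edges_scale (n : nat) : R := 2 `^ (n%:R ^+ 2 / 4).

Lemma exp_gauss n k : (k <= n)%N ->
  (2 ^ (k * (n - k)))%:R = edges_scale n * gauss n (Posz k - Posz (uphalf n)).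
Proof.
move=> kn; rewrite natrX -powR_mulrn // -powRD; last by apply/implyP.
congr (_ `^ _); rewrite natrM natrB // intrB -!pmulrn.
have -> : (uphalf n)%:R = (n%:R + (odd n)%:R) / 2 :> R.
  have /(congr1 (fun m => m%:R : R)) : (uphalf n + uphalf n = n + odd n)%N by lia.
  by rewrite !natrD; lra.
by field.
Qed.

Definition split_scale (n : nat) : R := 'C(n, uphalf n)%:R * edges_scale n.

Lemma split_scale_gt0 n : 0 < split_scale n.
Proof. by rewrite mulr_gt0 ?powR_gt0 // ltr0n bin_gt0; lia. Qed.

(** Each binomial is replaced by the central one; what remains is a finite part of the Gaussian
    series, as the shift is injective. *)
Lemma central_sum_le n : (central_sum n)%:R <= split_scale n * split_const R n.
Proof.
rewrite /central_sum natr_sum.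
pose e (k : nat) := Posz k - Posz (uphalf n).
apply: (@le_trans _ _ (\sum_(k < n.+1) split_scale n * gauss n (e k))).
  rewrite big_mkcond; apply: ler_sum => k _; case: ifP => _; last first.
    by rewrite mulr_ge0 ?gauss_ge0 // ltW // split_scale_gt0.
  rewrite natrM exp_gauss; last by rewrite -ltnS.
  by rewrite mulrA ler_wpM2r ?gauss_ge0 // ler_wpM2r ?powR_ge0 // ler_nat bin_uphalf_max.
rewrite -mulr_sumr ler_pM2l ?split_scale_gt0 //.
rewrite -(big_mkord xpredT (fun k => gauss n (e k))) -(big_map e xpredT (gauss n)).
apply: split_const_ub; rewrite map_inj_uniq ?iota_uniq // => k k'.
by rewrite /e; lia.
Qed.

Lemma bin_uphalf_ge n J (i : int) : (absz i <= J)%N -> (J < uphalf n)%N ->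
  'C(n, uphalf n)%:R * (1 - (J * J.+1)%:R / (uphalf n)%:R)
    <= 'C(n, absz (Posz (uphalf n) + i))%:R :> R.
Proof.
move=> iJ Jg; set g := uphalf n in Jg *.
have g0 : (0 : R) < g%:R by rewrite ltr0n; lia.
have h : ('C(n, g) * g <= 'C(n, absz (Posz g + i)%R) * g + J * J.+1 * 'C(n, g))%N.
  have [j [jJ]] : exists j, (j <= J)%N /\
      (absz (Posz g + i)%R = g + j \/ absz (Posz g + i)%R = g - j)%N.
    by exists (absz i); split => //; lia.
  have jM : (j * j.+1 * 'C(n, g) <= J * J.+1 * 'C(n, g))%N.
    by rewrite leq_mul2r leq_mul ?orbT.
  case=> ->; [have M := bin_uphalf_add n j|have M := bin_uphalf_sub n j ltac:(lia)];
    by apply: leq_trans M _; rewrite leq_add2l.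
rewrite -(ler_pM2r g0) -mulrA mulrBl mul1r divfK ?gt_eqF // mulrBr.
rewrite lerBlDr -!natrM -natrD ler_nat; apply: leq_trans h _.
by rewrite leq_add2l mulnC.
Qed.

(** Only the sizes k = [uphalf n] + i with i in s are kept. The bound on n makes them central and
    keeps J below [uphalf n]. *)
Lemma central_sum_ge n J (s : seq int) : uniq s ->
  (forall i, i \in s -> (absz i <= J)%N) -> (4 * J + 4 <= n)%N ->
  split_scale n * (1 - (J * J.+1)%:R / (uphalf n)%:R) * \sum_(i <- s) gauss n i
    <= (central_sum n)%:R.
Proof.
move=> us sJ nJ; set g := uphalf n.
pose e (i : int) := absz (Posz g + i)%R.
have eE i : i \in s -> Posz (e i) = Posz g + i by move=> /sJ; rewrite /e /g; lia.
pose F k : R := ('C(n, k) * 2 ^ (k * (n - k)))%:R.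
have -> : (central_sum n)%:R = \sum_(k <- [seq k <- iota 0 n.+1 | central n k]) F k.
  by rewrite big_filter natr_sum -[iota _ _]/(index_iota 0 n.+1) big_mkord.
apply: (@le_trans _ _ (\sum_(k <- [seq e i | i <- s]) F k)); last first.
  apply: ler_sum_subseq => [i||k /seq.mapP[i si ->]]; first exact: ler0n.
    rewrite map_inj_in_uniq // => i j si sj eij.
    by have := eE i si; rewrite eij (eE j sj); lia.
  have := eE i si; have := sJ i si.
  by rewrite mem_filter mem_iota /central /g; lia.
rewrite big_map mulr_sumr !big_seq; apply: ler_sum => i si.
have kn : (e i <= n)%N by have := eE i si; have := sJ i si; rewrite /g; lia.
rewrite /F (natrM _ 'C(n, e i)) exp_gauss // (eE i si) [Posz g + i]addrC addrK.
rewrite /split_scale mulrA ler_wpM2r ?gauss_ge0 // mulrAC ler_wpM2r ?powR_ge0 //.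
by apply: bin_uphalf_ge; [exact: sJ|lia].
Qed.

Lemma split_scale_ge n : (2 ^ (n ^ 2 %/ 4))%:R <= split_scale n.
Proof.
rewrite -[X in X <= _]mul1r; apply: ler_pM => //.
  by rewrite ler1n bin_gt0; lia.
rewrite natrX -powR_mulrn //; apply: ler_powR; first by lra.
by rewrite ler_pdivlMr // -natrX -natrM ler_nat leq_trunc_div.
Qed.

(** The relative error in both bounds, of order at most 1 / n by [cube_le_exp]. *)
Definition split_error (n : nat) : R := (n ^ 2)%:R / (2 ^ (n %/ 16))%:R.

Lemma split_error_ge0 n : 0 <= split_error n.
Proof. by rewrite divr_ge0. Qed.

Lemma split_error_le n : (0 < n)%N -> split_error n <= 64 ^+ 3 / n%:R.
Proof.
move=> n0; rewrite ler_pdivrMr ?ltr0n ?expn_gt0 // mulrAC ler_pdivlMr ?ltr0n //.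
by rewrite -natrX -!natrM ler_nat -expnSr cube_le_exp.
Qed.

(** The factor 1 + [split_error n] comes from non-identity permutations, the last summand from
    cliques outside the central range. *)
Lemma num_split_ub n : (1024 <= n)%N ->
  (num_unlabeled_split n)%:R * n`!%:R
    <= split_scale n * ((1 + split_error n) * split_const R n + split_error n).
Proof.
move=> n1; have q0 : (0 : R) < (2 ^ (n %/ 16))%:R by rewrite ltr0n expn_gt0.
have n2 : (n <= 2 ^ (n %/ 16))%N.
  by apply: leq_trans (double_le_exp n n1); rewrite leq_pmull.
have := num_split_upper n n2; rewrite -(ler_nat R) natrD !natrM => h.
have := far_sum_bound n n1; rewrite -(ler_nat R) !natrM -(natrM R n n) mulnn => far.
have W2 := split_scale_ge n.
have B := central_sum_le n.
rewrite -(ler_pM2r q0); apply: le_trans h _.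
have eq : split_error n * (2 ^ (n %/ 16))%:R = (n ^ 2)%:R by rewrite divfK ?gt_eqF.
rewrite natrD -eq.
have e0 := split_error_ge0 n.
apply: (@le_trans _ _ (((2 ^ (n %/ 16))%:R + split_error n * (2 ^ (n %/ 16))%:R)
    * (split_scale n * split_const R n) + (n ^ 2)%:R * split_scale n)).
  apply: lerD; first by rewrite ler_wpM2l // addr_ge0 // ?mulr_ge0 // ltW.
  by rewrite mulrC; apply: le_trans far _; apply: ler_wpM2l.
rewrite -eq le_eqVlt; apply/orP; left; apply/eqP.
by move: (split_error n) (2 ^ _)%:R => e Q; ring.
Qed.

Lemma num_split_lb n : (16 <= n)%N ->
  (1 - 2 * split_error n) * (central_sum n)%:R <= (num_unlabeled_split n)%:R * n`!%:R.
Proof.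
move=> n1; have q0 : (0 : R) < (2 ^ (n %/ 16))%:R by rewrite ltr0n expn_gt0.
have := num_split_lower n n1; rewrite -(ler_nat R) natrD !natrM -(natrM R n n) mulnn => h.
have eq : split_error n * (2 ^ (n %/ 16))%:R = (n ^ 2)%:R by rewrite divfK ?gt_eqF.
rewrite -(ler_pM2r q0) mulrBl mul1r mulrBl lerBlDr; apply: le_trans h _.
rewrite -eq le_eqVlt; apply/orP; left; apply/eqP.
by move: (split_error n) (2 ^ _)%:R => e Q; ring.
Qed.

End Gauss.

(** * The limit *)

Section Ratio.

Local Open Scope ring_scope.

Variable R : realType.

(** Writing n! as the central binomial times the two half factorials matches the stated denominator
    with [split_scale]. *)
Lemma num_split_ratioE n :
  (num_unlabeled_split n)%:R /
     (split_const R n / ((n./2)`!%:R * (uphalf n)`!%:R) * edges_scale R n)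
  = (num_unlabeled_split n)%:R * n`!%:R / (split_scale R n * split_const R n).
Proof.
have c0 : split_const R n != 0.
  by have := split_const_ge R n; apply: contraTneq => ->; rewrite -ltNge invr_gt0.
have e0 : edges_scale R n != 0 by rewrite gt_eqF // powR_gt0.
have b0 : 'C(n, uphalf n)%:R != 0 :> R by rewrite pnatr_eq0 -lt0n bin_gt0; lia.
have f0 m : m`!%:R != 0 :> R by rewrite pnatr_eq0 -lt0n fact_gt0.
have nE : n`! = ('C(n, uphalf n) * ((uphalf n)`! * (n./2)`!))%N.
  rewrite (_ : n./2 = n - uphalf n)%N; last by lia.
  by rewrite bin_fact //; lia.
rewrite nE /split_scale !natrM; have := f0 n./2; have := f0 (uphalf n).
move: c0 e0 b0.
move: (_ %:R) (split_const _ _) (edges_scale _ _) ('C(_, _))%:R (uphalf n)`!%:R (n./2)`!%:R.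
by move=> s c P b x y c0 P0 b0 x0 y0; field; rewrite c0 P0 b0 x0 y0.
Qed.

Lemma num_split_ratio_near (s : seq int) (J n : nat) (d : R) :
  0 < d -> d <= 1 -> uniq s -> (forall i, i \in s -> (absz i <= J)%N) ->
  split_const R n - d / 8 < \sum_(i <- s) gauss R n i ->
  (4 * J + 4 <= n)%N -> (1024 <= n)%N ->
  8 * (J * J.+1)%:R / d <= n%:R -> 8 * 64 ^+ 3 / d <= n%:R ->
  `| 1 - (num_unlabeled_split n)%:R * n`!%:R / (split_scale R n * split_const R n) | <= d.
Proof.
move=> d0 d1 us sJ sc nJ n1 nJ' nT.
have [n0' n16 g0' g2'] :
    [/\ 0 < n, 16 <= n, 0 < uphalf n & n <= 2 * uphalf n]%N by clear -n1; split; lia.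
have n0 : (0 : R) < n%:R by rewrite ltr0n.
have W0 := split_scale_gt0 R n; have c2 := split_const_ge R n.
have ub := num_split_ub R n n1; have lb := num_split_lb R n n16.
have B := central_sum_ge R n J s us sJ nJ.
have t0 := split_error_ge0 R n.
have t1 : split_error R n <= d / 8.
  apply: le_trans (split_error_le R n n0') _.
  rewrite ler_pdivrMr // mulrC; move: nT; rewrite ler_pdivrMr //.
  by move: (64 ^+ 3) => z; nra.
have g2 : (n%:R : R) <= 2 * (uphalf n)%:R by rewrite -natrM ler_nat.
have g0 : (0 : R) < (uphalf n)%:R by rewrite ltr0n.
have h1 : (J * J.+1)%:R / (uphalf n)%:R <= d / 4.
  rewrite ler_pdivrMr //; move: nJ'; rewrite ler_pdivrMr //.
  by move: (J * _)%:R => z; nra.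
have h0 : 0 <= (J * J.+1)%:R / (uphalf n)%:R :> R by rewrite divr_ge0.
move: ub lb B; set a := _ * n`!%:R; set W := split_scale R n in W0 *.
move: c2 sc h0 h1; set c := split_const R n; set h := _ / (uphalf n)%:R.
set S := \sum_(i <- s) _; move: t0 t1; set t := split_error R n.
move=> t0 t1 c2 sc h0 h1 ub lb B.
have Wc0 : 0 < W * c by rewrite mulr_gt0 //; lra.
have lo : W * c * (1 - d) <= a.
  apply: le_trans lb; apply: (@le_trans _ _ ((1 - 2 * t) * (W * (1 - h) * S))); last first.
    by apply: ler_wpM2l B; lra.
  (* Since c >= 1/2, the additive loss d / 8 is at most c d / 4. *)
  have cS : c * (1 - d / 4) <= S by nra.
  have -> : (1 - 2 * t) * (W * (1 - h) * S) = W * ((1 - 2 * t) * (1 - h) * S) by ring.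
  rewrite -mulrA; apply: ler_wpM2l; first exact: ltW.
  have th : 1 - d / 2 <= (1 - 2 * t) * (1 - h) by nra.
  apply: (@le_trans _ _ ((1 - d / 2) * (c * (1 - d / 4)))).
    have -> : (1 - d / 2) * (c * (1 - d / 4)) = c * ((1 - d / 2) * (1 - d / 4)) by ring.
    by apply: ler_wpM2l; [lra|nra].
  by apply: ler_pM => //; [lra|apply: mulr_ge0; lra].
(* Again by c >= 1/2, the summand t is at most 2 t c, so the bound is c (1 + 3 t) with 3 t <= 3 d /
   8. *)
have hi : a <= W * c * (1 + d).
  apply: le_trans ub _; rewrite -mulrA; apply: ler_wpM2l; first exact: ltW.
  by nra.
rewrite ler_distlC; apply/andP; split.
  by rewrite ler_pdivlMr // mulrC.
by rewrite ler_pdivrMr // mulrC.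
Qed.

End Ratio.

Local Open Scope classical_set_scope.
Local Open Scope ring_scope.

Theorem corollary3p12 (R : realType) :
  (fun n : nat =>
     (num_unlabeled_split n)%:R /
     (split_const R n / ((n./2)`!%:R * (uphalf n)`!%:R) *
        (2 : R) `^ (n%:R ^+ 2 / 4)))
    @ \oo --> (1 : R).
Proof.
apply/cvgrPdist_le => e e0; pose d := Num.min e 1.
have d0 : 0 < d by rewrite lt_min e0 ltr01.
have d8 : 0 < d / 8 by rewrite divr_gt0.
(* The constant depends only on the parity of n, so two finite index sets, taken at n = 0 and n = 1,
   serve all n. *)
have [s0 us0 sc0] := split_const_adherent R 0 _ d8.
have [s1 us1 sc1] := split_const_adherent R 1 _ d8.
pose J := (\max_(i <- s0 ++ s1) absz i)%N.
near=> n; rewrite -/(edges_scale R n) num_split_ratioE.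
apply: (@le_trans _ _ d); last by rewrite ge_min lexx.
apply: (num_split_ratio_near R (if odd n then s1 else s0) J) => //.
- by rewrite ge_min lexx orbT.
- by case: ifP.
- move=> i si; apply: leq_bigmax_seq => //.
  by rewrite mem_cat; case: ifP si => _ ->; rewrite ?orbT.
- case: ifP => on.
    rewrite (split_const_odd R n 1 on); under eq_bigr do rewrite (gauss_odd R n 1 on).
    exact: sc1.
  rewrite (split_const_odd R n 0 on); under eq_bigr do rewrite (gauss_odd R n 0 on).
  exact: sc0.
- by near: n; exact: nbhs_infty_ge.
- by near: n; exact: nbhs_infty_ge.
- by near: n; exact: nbhs_infty_ger.
- by near: n; exact: nbhs_infty_ger.
Unshelve. all: by end_near. Qed.
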